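(* Let $A$ be a real symmetric $n\times n$ matrix, $b\in\mathbb{R}^n$, $c\in\mathbb{R}$, $a_1,\dots,a_m\in\mathbb{R}^n$, $b_1,\dots,b_m\in\mathbb{R}$, and $B=\{1,\dots,s\}$ with $s\le n$. Consider the mixed integer quadratic program $$(P_M)\quad \inf_{x\in\mathbb{R}^n}\ x^TAx+b^Tx+c\quad\text{s.t.}\quad a_j^Tx=b_j,\ j=1,\dots,m,\quad x_i\in\{0,1\},\ i\in B,\quad x\ge 0,$$ and assume that its feasible set is nonempty. Let $f(x)=x^TAx+b^Tx+c$ and let $g_1,\dots,g_{4m+2s}$ be the functions $$g_j(x)=\begin{cases} a_j^Tx-b_j, & j=1,\dots,m,\\ -a_{j-m}^Tx+b_{j-m}, & j=m+1,\dots,2m,\\ (a_{j-2m}^Tx)^2-b_{j-2m}^2, & j=2m+1,\dots,3m,\\ -(a_{j-3m}^Tx)^2+b_{j-3m}^2, & j=3m+1,\dots,4m,\\ x_{j-4m}(x_{j-4m}-1), & j=4m+1,\dots,4m+s,\\ -x_{j-4m-s}(x_{j-4m-s}-1), & j=4m+s+1,\dots,4m+2s.\end{cases}$$ Let $$\mathcal{A}_{P_D}:=\{(g_1(x),\dots,g_{4m+2s}(x),f(x)) : x\in\mathbb{R}^n_+\}+\mathbb{R}^{4m+2s+1}_+ .$$ Suppose that the following two conditions hold: (RA) if $d\in\mathbb{R}^n_+$ and $a_j^Td=b_j$ for $j=1,\dots,m$, then $0\le d_i\le 1$ for all $i\in B$; and $$\{d\in\mathbb{R}^n_+ : d^TAd\le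 0,\ a_j^Td=0,\ j=1,\dots,m,\ d_i=0,\ 1\le i\le s\}=\{0_{\mathbb{R}^n}\}.$$ Then $$(\{0_{\mathbb{R}^{4m+2s}}\}\times\mathbb{R})\cap\operatorname{cl}\operatorname{conv}\mathcal{A}_{P_D}=(\{0_{\mathbb{R}^{4m+2s}}\}\times\mathbb{R})\cap\mathcal{A}_{P_D},$$ so that $(P_M)$ admits hidden convexifiability. Moreover, $\inf(P_M)=\sup(D_M)$, where $$(D_M)\quad \sup_{u\in\mathbb{R}^{4m+2s}_+}\ \inf_{x\in\mathbb{R}^n_+}\Big\{f(x)+\sum_{j=1}^{4m+2s}u_jg_j(x)\Big\}.$$
   Context: The problem $(P_M)$ is equivalent to the continuous quadratic program $$(P_D)\quad \inf_x f(x)\quad\text{s.t.}\quad g_j(x)\le 0,\ j=1,\dots,4m+2s,\ x\in\mathbb{R}^n_+.$$ $(P_M)$ is said to admit hidden convexifiability if $(P_D)$ is convexifiable, i.e. if $(\{0_{\mathbb{R}^{4m+2s}}\}\times\mathbb{R})\cap\operatorname{cl}\operatorname{conv}\mathcal{A}_{P_D}=(\{0_{\mathbb{R}^{4m+2s}}\}\times\mathbb{R})\cap\mathcal{A}_{P_D}$. Here $\operatorname{cl}$ and $\operatorname{conv}$ denote closure and convex hull, $\mathbb{R}^k_+$ is the nonnegative orthant, and $\inf(\cdot)$, $\sup(\cdot)$ denote optimal values. *)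

(* Defs.v *)
From HB Require Import structures.
From mathcomp Require Import all_boot all_order all_algebra.
From mathcomp Require Import all_classical all_reals all_analysis.
From mathcomp Require Import zify.

Set Implicit Arguments.
Unset Strict Implicit.
Unset Printing Implicit Defensive.

Import Order.TTheory GRing.Theory Num.Theory.
Import numFieldNormedType.Exports.

Local Open Scope classical_set_scope.
Local Open Scope ring_scope.

(* R^k is the type 'cV[R]_k of column vectors, with its library topology
   (entrywise convergence), and x i 0 is the i-th coordinate of x. Indices
   start at 0, so B = {1, ..., s} is the set of the i : 'I_n with i < s. *)

Definition dotv (R : realType) (n : nat) (u x : 'cV[R]_n) : R :=
  (u^T *m x) 0 0.

Definition qform (R : realType) (n : nat) (A : 'M[R]_n) (x : 'cV[R]_n) : R :=
  (x^T *m A *m x) 0 0.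

Definition orthant (R : realType) (k : nat) : set 'cV[R]_k :=
  [set x | forall i, 0 <= x i 0].
Arguments orthant R k : clear implicits.

Definition conv_hull (R : realType) (k : nat) (S : set 'cV[R]_k) :
    set 'cV[R]_k :=
  smallest (@convex_set R 'cV[R]_k) S.

(* {0_{R^p}} x R, as a subset of R^(p + 1) *)
Definition zero_times_line (R : realType) (p : nat) : set 'cV[R]_(p + 1) :=
  [set col_mx 0 (const_mx r) | r in [set: R]].
Arguments zero_times_line R p : clear implicits.

(* {(g_1(x), ..., g_p(x), f(x)) : x in D} + R^(p + 1)_+ *)
Definition image_set (R : realType) (n p : nat) (D : set 'cV[R]_n)
    (g : 'cV[R]_n -> 'cV[R]_p) (f : 'cV[R]_n -> R) : set 'cV[R]_(p + 1) :=
  [set y + v | y in [set col_mx (g x) (const_mx (f x)) | x in D]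
             & v in orthant R (p + 1)].

(* Convexifiability of  inf { f(x) : g_j(x) <= 0 for all j, x in D } *)
Definition convexifiable (R : realType) (n p : nat) (D : set 'cV[R]_n)
    (g : 'cV[R]_n -> 'cV[R]_p) (f : 'cV[R]_n -> R) : Prop :=
  zero_times_line R p `&` closure (conv_hull (image_set D g f)) =
  zero_times_line R p `&` image_set D g f.

Definition lagrangian (R : realType) (n p : nat)
    (g : 'cV[R]_n -> 'cV[R]_p) (f : 'cV[R]_n -> R)
    (u : 'cV[R]_p) (x : 'cV[R]_n) : R :=
  f x + \sum_(j < p) u j 0 * g x j 0.

Definition dual_value (R : realType) (n p : nat) (D : set 'cV[R]_n)
    (g : 'cV[R]_n -> 'cV[R]_p) (f : 'cV[R]_n -> R) : \bar R :=
  ereal_sup [set ereal_inf [set (lagrangian g f u x)%:E | x in D]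
            | u in orthant R p].

Definition objective (R : realType) (n : nat) (A : 'M[R]_n) (b : 'cV[R]_n)
    (c : R) (x : 'cV[R]_n) : R :=
  qform A x + dotv b x + c.

Definition miqp_feasible (R : realType) (n m s : nat)
    (a : 'I_m -> 'cV[R]_n) (beta : 'I_m -> R) : set 'cV[R]_n :=
  [set x | [/\ forall j, dotv (a j) x = beta j,
               forall i : 'I_n, (i < s)%N -> x i 0 = 0 \/ x i 0 = 1
             & orthant R n x]].

Definition miqp_value (R : realType) (n m s : nat) (A : 'M[R]_n)
    (b : 'cV[R]_n) (c : R) (a : 'I_m -> 'cV[R]_n) (beta : 'I_m -> R) : \bar R :=
  ereal_inf [set (objective A b c x)%:E | x in miqp_feasible s a beta].

(* The six blocks of constraints, of sizes m, m, m, m, s, s. *)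
Definition ncon (m s : nat) : nat := (m + (m + (m + (m + (s + s)))))%N.

Lemma nconE (m s : nat) : ncon m s = (4 * m + 2 * s)%N.
Proof. by rewrite /ncon; lia. Qed.

Definition constraints (R : realType) (n m s : nat) (hs : (s <= n)%N)
    (a : 'I_m -> 'cV[R]_n) (beta : 'I_m -> R) (x : 'cV[R]_n) :
    'cV[R]_(ncon m s) :=
  let lin : 'cV[R]_m := \col_j (dotv (a j) x - beta j) in
  let sqr : 'cV[R]_m := \col_j (dotv (a j) x ^+ 2 - beta j ^+ 2) in
  let bin : 'cV[R]_s :=
    \col_i (x (widen_ord hs i) 0 * (x (widen_ord hs i) 0 - 1)) in
  col_mx lin (col_mx (- lin) (col_mx sqr (col_mx (- sqr)
    (col_mx bin (- bin))))).

Definition hidden_convexifiable (R : realType) (n m s : nat) (hs : (s <= n)%N)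
    (A : 'M[R]_n) (b : 'cV[R]_n) (c : R)
    (a : 'I_m -> 'cV[R]_n) (beta : 'I_m -> R) : Prop :=
  convexifiable (orthant R n) (constraints hs a beta) (objective A b c).

(* Main.v *)
Require Import Defs.
From HB Require Import structures.
From mathcomp Require Import all_boot all_order all_algebra.
From mathcomp Require Import all_classical all_reals all_analysis.
From mathcomp Require Import ring lra.

(* The feasible set of (P_M) is cut out of the orthant by two nonnegative
   penalties: the sum E of the (a_j^T x - b_j)^2 and, on the polyhedron E = 0
   where (RA) gives 0 <= x_i <= 1, the sum S of the x_i (1 - x_i), i in B. By
   (RA) a direction d >= 0 with a_j^T d = 0 for all j has d_i = 0 on B, so the
   second assumption says that A is positive on the nonzero ones; hence, for
   each L, f + L S + K E has a form positive on the simplex, and is coercive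
   on the orthant, once K is large. Two exact-penalty steps (first L, then K)
   give f + L S + K E > min(P_M) - e on the orthant, and f + L S + K E is a
   Lagrangian of (P_D) with nonnegative multipliers. Each such Lagrangian
   bounds cl conv A_{P_D} by a closed half-space and bounds the dual value
   from below, and min(P_M) is attained. *)

Set Implicit Arguments.
Unset Strict Implicit.
Unset Printing Implicit Defensive.

Import Order.TTheory GRing.Theory Num.Theory.
Import numFieldNormedType.Exports.

Local Open Scope classical_set_scope.
Local Open Scope ring_scope.

(** * Continuity of the forms and closedness of level sets *)

Lemma continuous_add (R : realType) (T : topologicalType) (f g : T -> R) :
  continuous f -> continuous g -> continuous (fun x => f x + g x).
Proof. by move=> cf cg x; apply: cvgD; [exact: cf | exact: cg]. Qed.

Lemma continuous_mul (R : realType) (T : topologicalType) (f g : T -> R) :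
  continuous f -> continuous g -> continuous (fun x => f x * g x).
Proof. by move=> cf cg x; apply: cvgM; [exact: cf | exact: cg]. Qed.

Lemma continuous_scale (R : realType) (T : topologicalType) (f : T -> R)
    (k : R) : continuous f -> continuous (fun x => k * f x).
Proof. by move=> cf; apply: continuous_mul => //; exact: cst_continuous. Qed.

Lemma continuous_bigsum (R : realType) (T : topologicalType) (I : Type)
    (r : seq I) (P : pred I) (F : I -> T -> R) :
  (forall i, continuous (F i)) ->
  continuous (fun x => \sum_(i <- r | P i) F i x).
Proof.
move=> cF; elim: r => [|i r IH].
  rewrite (_ : (fun _ => _) = cst 0); first exact: cst_continuous.
  by apply/funext => x; rewrite big_nil.
rewrite (_ : (fun _ => _) = (fun x => (if P i then F i x else 0) +
    \sum_(j <- r | P j) F j x)); last first.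
  by apply/funext => x; rewrite big_cons; case: ifP => // _; rewrite add0r.
move=> x; apply: cvgD; last exact: IH.
by case: ifP => // _; [exact: cF | exact: cst_continuous].
Qed.

Lemma dotvE (R : realType) (n : nat) (u x : 'cV[R]_n) :
  dotv u x = \sum_i u i 0 * x i 0.
Proof. by rewrite /dotv mxE; apply: eq_bigr => i _; rewrite mxE. Qed.

Lemma qformE (R : realType) (n : nat) (A : 'M[R]_n) (x : 'cV[R]_n) :
  qform A x = \sum_j (\sum_i x i 0 * A i j) * x j 0.
Proof.
rewrite /qform mxE; apply: eq_bigr => j _; congr (_ * _).
by rewrite mxE; apply: eq_bigr => i _; rewrite mxE.
Qed.

Lemma dotvD (R : realType) (n : nat) (u x y : 'cV[R]_n) :
  dotv u (x + y) = dotv u x + dotv u y.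
Proof. by rewrite /dotv mulmxDr mxE. Qed.

Lemma dotvZ (R : realType) (n : nat) (u x : 'cV[R]_n) (t : R) :
  dotv u (t *: x) = t * dotv u x.
Proof. by rewrite /dotv -scalemxAr mxE. Qed.

Lemma qformZ (R : realType) (n : nat) (A : 'M[R]_n) (x : 'cV[R]_n) (t : R) :
  qform A (t *: x) = t ^+ 2 * qform A x.
Proof.
rewrite /qform (_ : (t *: x)^T = t *: x^T).
  by rewrite -!scalemxAl -scalemxAr !mxE mulrA -expr2.
by apply/matrixP => i j; rewrite !mxE.
Qed.

Lemma coord_cV_continuous (R : realType) (n : nat) (i : 'I_n) :
  continuous (fun x : 'cV[R]_n => x i 0).
Proof. exact: (@coord_continuous R n 1 i 0). Qed.

Lemma continuous_dotv (R : realType) (n : nat) (u : 'cV[R]_n) :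
  continuous (dotv u).
Proof.
rewrite (_ : dotv u = fun x => \sum_i u i 0 * x i 0); last first.
  by apply/funext => x; rewrite dotvE.
refine (continuous_bigsum _) => i.
exact: continuous_scale (@coord_cV_continuous R n i).
Qed.

Lemma continuous_qform (R : realType) (n : nat) (A : 'M[R]_n) :
  continuous (qform A).
Proof.
rewrite (_ : qform A = fun x => \sum_j (\sum_i A i j * x i 0) * x j 0).
  refine (continuous_bigsum _) => j.
  refine (continuous_mul _ (@coord_cV_continuous R n j)).
  refine (continuous_bigsum _) => i.
  exact: continuous_scale (@coord_cV_continuous R n i).
apply/funext => x; rewrite qformE; apply: eq_bigr => j _; congr (_ * _).
by apply: eq_bigr => i _; rewrite mulrC.
Qed.

Lemma continuous_objective (R : realType) (n : nat) (A : 'M[R]_n)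
    (b : 'cV[R]_n) (c : R) : continuous (objective A b c).
Proof.
refine (continuous_add _ (@cst_continuous _ _ c)).
exact: continuous_add (@continuous_qform _ _ A) (@continuous_dotv _ _ b).
Qed.

Lemma closed_sublevel (R : realType) (T : topologicalType) (f : T -> R)
    (v : R) : continuous f -> closed [set x | f x <= v].
Proof. by move=> /continuous_closedP cf; exact: (cf _ (@closed_le R v)). Qed.

Lemma closed_superlevel (R : realType) (T : topologicalType) (f : T -> R)
    (v : R) : continuous f -> closed [set x | v <= f x].
Proof. by move=> /continuous_closedP cf; exact: (cf _ (@closed_ge R v)). Qed.

Lemma closed_level (R : realType) (T : topologicalType) (f : T -> R)
    (v : R) : continuous f -> closed [set x | f x = v].
Proof. by move=> /continuous_closedP cf; exact: (cf _ (@closed_eq R v)). Qed.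

Lemma closed_forall (T : topologicalType) (J : Type) (P : J -> T -> Prop) :
  (forall i, closed [set x | P i x]) -> closed [set x | forall i, P i x].
Proof.
move=> cP; rewrite (_ : [set x | _] = \bigcap_i [set x | P i x]).
  by apply: closed_bigI => i _; exact: cP.
by apply/seteqP; split => x Px i; [move=> _; exact: Px | exact: (Px i I)].
Qed.

Lemma closed_orthant (R : realType) (n : nat) : closed (orthant R n).
Proof.
apply: closed_forall => i.
by apply: closed_superlevel; exact: coord_cV_continuous.
Qed.

(** * Compactness, attained minima and exact penalties *)

Definition entry_bounded (R : realType) (n : nat) (S : set 'cV[R]_n) :=
  exists M : R, forall x, S x -> forall i, `|x i 0| <= M.

Lemma trmx_continuous (R : realType) (m n : nat) :
  continuous (@trmx R m n : 'M[R]_(m, n) -> 'M[R]_(n, m)).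
Proof.
move=> M s /= /(nbhs_ballP M^T) [e e0 es].
apply/nbhs_ballP; exists e => //= N [_ MN].
apply: es; split => // i j; rewrite !mxE; exact: MN.
Qed.

(** A product of segments is compact as a set of row vectors; its image under the continuous
    transpose is a compact box of columns containing [S]. *)
Lemma closed_entry_bounded_compact (R : realType) (n : nat)
    (S : set 'cV[R]_n) : closed S -> entry_bounded S -> compact S.
Proof.
move=> cS [M SM].
pose box := [set v : 'rV[R]_n | forall i, `[- M, M]%classic (v ord0 i)].
have cbox : compact (trmx @` box : set 'cV[R]_n).
  apply: continuous_compact.
    by apply: continuous_subspaceT; exact: trmx_continuous.
  apply: (@rV_compact _ _ (fun=> `[- M, M]%classic)) => _.
  exact: segment_compact.
apply: subclosed_compact cS cbox _ => x /SM Mx.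
exists x^T; last by rewrite trmxK.
by move=> i /=; rewrite mxE in_itv /= -ler_norml; exact: Mx.
Qed.

Lemma compact_min (R : realType) (T : topologicalType) (f : T -> R)
    (S : set T) :
  S !=set0 -> compact S -> continuous f ->
  exists2 x, S x & forall y, S y -> f x <= f y.
Proof.
move=> S0 cS cf.
have [x xS mx] := compact_EVT_min S0 cS (continuous_subspaceT cf).
by exists x => [|y yS]; [rewrite inE in xS | apply: mx; rewrite inE].
Qed.

(* Where f > v or f + K0 p > v there is nothing to prove for K >= max(0, K0);
   the rest of D is compact, with p bounded away from 0 and f bounded below. *)
Lemma penalty (R : realType) (n : nat) (D : set 'cV[R]_n)
    (f p : 'cV[R]_n -> R) (K0 v : R) :
  closed D -> continuous f -> continuous p ->
  (forall x, D x -> 0 <= p x) ->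
  entry_bounded (D `&` [set x | f x + K0 * p x <= v]) ->
  (forall x, D x -> p x = 0 -> v < f x) ->
  exists2 K, 0 <= K & forall x, D x -> v < f x + K * p x.
Proof.
move=> cD cf cp p0 [M bD] pf.
have cfp : continuous (fun x => f x + K0 * p x).
  exact: continuous_add cf (continuous_scale cp).
pose S := D `&` [set x | f x + K0 * p x <= v] `&` [set x | f x <= v].
have S_compact : compact S.
  apply: closed_entry_bounded_compact.
    by apply: closedI; [apply: closedI => //|]; exact: closed_sublevel.
  by exists M => x -[/bD].
have [S0|/nonemptyPn S0] := pselect (S !=set0); last first.
  exists (Num.max 0 K0) => [|x Dx]; first by rewrite le_max lexx.
  have px := p0 _ Dx.
  have [fx|//] := leP (f x + Num.max 0 K0 * p x) v; exfalso.
  have : S x.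
    split=> /=; last first.
      by apply: le_trans fx; rewrite lerDl mulr_ge0// le_max lexx.
    split => //=; apply: le_trans fx.
    by rewrite lerD2l ler_wpM2r// le_max lexx orbT.
  by rewrite S0.
have [y [[Dy _] fy] ymin] := compact_min S0 S_compact cp.
have [z _ zmin] := compact_min S0 S_compact cf.
have py : 0 < p y.
  rewrite lt_neqAle p0// andbT eq_sym; apply/eqP => /(pf _ Dy).
  by rewrite ltNge => /negP; apply.
(* As [p y] and [f z] are the minima of [p] and [f] on [S], every [x] in [S] satisfies [f x + K * p
   x >= f z + K * p y >= v + p y > v]. *)
pose K := Num.max (Num.max 0 K0) ((v - f z) / p y + 1).
have K0_ge : 0 <= K by rewrite !le_max lexx.
have KK0 : K0 <= K by rewrite !le_max lexx orbT.
have K1 : (v - f z) / p y + 1 <= K by rewrite le_max lexx orbT.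
exists K => // x Dx.
have px := p0 _ Dx.
have [fx|//] := leP (f x + K * p x) v; exfalso.
have Sx : S x.
  split=> /=; last by apply: le_trans fx; rewrite lerDl mulr_ge0.
  by split => //=; apply: le_trans fx; rewrite lerD2l ler_wpM2r.
have : K * p y <= K * p x by rewrite ler_wpM2l// ymin.
have : ((v - f z) / p y + 1) * p y <= K * p y by rewrite ler_pM2r.
rewrite mulrDl mul1r divfK ?gt_eqF//.
have := zmin _ Sx.
lra.
Qed.

(** * Growth and coercivity of quadratic functions on the orthant *)

Definition simplex (R : realType) (n : nat) : set 'cV[R]_n :=
  orthant R n `&` [set x | \sum_i x i 0 = 1].
Arguments simplex R n : clear implicits.

Lemma closed_simplex (R : realType) (n : nat) : closed (simplex R n).
Proof.
apply: closedI; first exact: closed_orthant.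
apply: closed_level; refine (continuous_bigsum _) => i.
exact: coord_cV_continuous.
Qed.

Lemma orthant_le_sum (R : realType) (n : nat) (x : 'cV[R]_n) (i : 'I_n) :
  orthant R n x -> `|x i 0| <= \sum_j x j 0.
Proof.
move=> x0; rewrite ger0_norm// (bigD1 i)//= lerDl.
by apply: sumr_ge0 => j _; exact: x0.
Qed.

Lemma entry_bounded_simplex (R : realType) (n : nat) :
  entry_bounded (simplex R n).
Proof. by exists 1 => x [x0 <-] i; exact: orthant_le_sum. Qed.

Lemma entry_boundedS (R : realType) (n : nat) (S T : set 'cV[R]_n) :
  S `<=` T -> entry_bounded T -> entry_bounded S.
Proof. by move=> ST [M TM]; exists M => x /ST; exact: TM. Qed.

(** The constant is the minimum of [Q] on the compact simplex; homogeneity carries the bound to [x]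
    after division by its coordinate sum. *)
Lemma quadratic_growth (R : realType) (n : nat) (Q : 'cV[R]_n -> R) :
  continuous Q -> (forall t x, Q (t *: x) = t ^+ 2 * Q x) ->
  (forall x, simplex R n x -> 0 < Q x) ->
  exists2 delta, 0 < delta &
    forall x, orthant R n x -> delta * (\sum_i x i 0) ^+ 2 <= Q x.
Proof.
move=> cQ QZ Qpos.
have [delta d0 dQ] : exists2 delta, 0 < delta &
    forall x, simplex R n x -> delta <= Q x.
  have [S0|/nonemptyPn S0] := pselect (simplex R n !=set0); last first.
    by exists 1 => // x; rewrite S0.
  have [x xS xmin] := compact_min S0 (closed_entry_bounded_compact
    (@closed_simplex R n) (@entry_bounded_simplex R n)) cQ.
  by exists (Q x) => //; exact: Qpos.
exists delta => // x x0; have [s0|s_neq0] := eqVneq (\sum_i x i 0) 0.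
  (* A nonnegative vector with zero coordinate sum is zero; written as [0 *: x], it has [Q x = 0] by
     homogeneity. *)
  have -> : x = 0 *: x.
    apply/matrixP => i j; rewrite ord1 !mxE mul0r.
    by apply/eqP; rewrite -normr_le0 -s0; exact: orthant_le_sum.
  by rewrite QZ expr0n mul0r big1 ?expr0n ?mulr0// => i _; rewrite mxE mul0r.
have s_gt0 : 0 < \sum_i x i 0.
  by rewrite lt_neqAle eq_sym s_neq0 sumr_ge0// => i _; exact: x0.
have /dQ : simplex R n ((\sum_i x i 0)^-1 *: x).
  split=> [i|/=].
    by rewrite mxE mulr_ge0 ?invr_ge0 ?(ltW s_gt0)//; exact: x0.
  by under eq_bigr do rewrite mxE; rewrite -mulr_sumr mulVf.
by rewrite QZ exprVn ler_pdivlMl ?exprn_gt0// mulrC.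
Qed.

Lemma dotv_bound (R : realType) (n : nat) (w x : 'cV[R]_n) :
  orthant R n x -> - ((\sum_i `|w i 0|) * \sum_i x i 0) <= dotv w x.
Proof.
move=> x0; apply: lerNnormlW.
rewrite dotvE (le_trans (ler_norm_sum _ _ _))// mulr_suml ler_sum// => i _.
by rewrite normrM ler_wpM2l// orthant_le_sum.
Qed.

(** With [s] the coordinate sum, the form grows at least like [delta * s ^+ 2], while the linear
    part is at least [- (B * s)]; so [s], and with it each entry, is bounded on a sublevel set. *)
Lemma coercive_quadratic (R : realType) (n : nat) (D : set 'cV[R]_n)
    (Q q : 'cV[R]_n -> R) (w : 'cV[R]_n) (k v : R) :
  D `<=` orthant R n ->
  continuous Q -> (forall t x, Q (t *: x) = t ^+ 2 * Q x) ->
  (forall x, simplex R n x -> 0 < Q x) ->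
  (forall x, D x -> q x = Q x + dotv w x + k) ->
  entry_bounded (D `&` [set x | q x <= v]).
Proof.
move=> Dpos cQ QZ Qpos qE; have [delta d0 dQ] := quadratic_growth cQ QZ Qpos.
set B := \sum_i `|w i 0|.
exists (Num.max 1 ((B + `|v - k|) / delta)) => x [Dx /=]; rewrite qE// => qx i.
have x0 := Dpos _ Dx.
apply: le_trans (orthant_le_sum i x0) _; set s := \sum_j x j 0.
have [s1|s1] := leP s 1; first by rewrite le_max s1.
rewrite le_max ler_pdivlMr//; apply/orP; right.
have := dQ _ x0; have := dotv_bound w x0; rewrite -/s -/B => wx Qx.
have vk := ler_norm (v - k); have nvk := normr_ge0 (v - k).
(* Here [1 < s] turns the constant term into a multiple of [s], so that a factor [s] can be
   cancelled. *)
have h : delta * s ^+ 2 <= B * s + `|v - k| * s by nra.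
by rewrite -(ler_pM2r (lt_trans ltr01 s1)); nra.
Qed.

(** * From Lagrangian lower bounds to convexifiability and duality *)

(** A multiplier [u], completed by 1 on the objective coordinate, is the normal of a closed
    half-space containing the image set, hence its closed convex hull; at a point (0, r) this reads
    [f x0 - e <= r]. The same multipliers bound the dual value from below, and evaluation of any
    Lagrangian at [x0], where [g] vanishes, bounds it from above. *)
Lemma strong_duality (R : realType) (n p : nat) (D : set 'cV[R]_n)
    (g : 'cV[R]_n -> 'cV[R]_p) (f : 'cV[R]_n -> R) (x0 : 'cV[R]_n) :
  D x0 -> g x0 = 0 ->
  (forall e, 0 < e -> exists2 u, orthant R p u &
     forall x, D x -> f x0 - e <= lagrangian g f u x) ->
  convexifiable D g f /\ dual_value D g f = (f x0)%:E.
Proof.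
move=> Dx0 gx0 dual; split.
  apply/seteqP; split=> y [yline yS]; split=> //; last first.
    by apply: subset_closure; exact: sub_gen_smallest.
  case: yline yS => r _ <- {y} yS.
  (* The point (0, r) is (g(x0), f(x0)) plus (0, r - f(x0)), and the latter is nonnegative once
     [f x0 <= r]. *)
  suff fr : f x0 <= r.
    exists (col_mx (g x0) (const_mx (f x0))); first by exists x0.
    exists (col_mx 0 (const_mx (r - f x0))).
      move=> i; rewrite mxE; case: splitP => j _; rewrite mxE ?lexx//.
      by rewrite subr_ge0.
    rewrite gx0 add_col_mx addr0; congr col_mx.
    by apply/matrixP => i j; rewrite !mxE subrKC.
  apply/ler_addgt0Pr => e e0; rewrite -lerBlDr.
  have [u u0 ulow] := dual e e0.
  pose w : 'cV[R]_(p + 1) := col_mx u (const_mx 1).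
  have wE (y : 'cV[R]_p) t :
      dotv w (col_mx y (const_mx t)) = t + \sum_j u j 0 * y j 0.
    rewrite dotvE big_split_ord big_ord1 /= addrC; congr (_ + _).
      by rewrite !col_mxEd !mxE mul1r.
    by apply: eq_bigr => j _; rewrite !col_mxEu.
  pose H := [set y | f x0 - e <= dotv w y].
  have : closure (conv_hull (image_set D g f)) `<=` H.
    have -> : H = closure H.
      by apply/closure_id/closed_superlevel/continuous_dotv.
    apply: closure_subset; apply: smallest_sub.
      move=> y z t; rewrite !inE /H /= => yH zH.
      rewrite [X in dotv _ X](_ : _ = t%:num *: y + (1 - t%:num) *: z)//.
      rewrite dotvD !dotvZ.
      have t0 : 0 <= t%:num by [].
      have t1 : t%:num <= 1 by [].
      nra.
    move=> _ [_ [x Dx <-]] [z z0 <-]; rewrite /H /= dotvD wE.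
    (* On the image of [x] the functional is the Lagrangian; the added vector [z] can only increase
       it, since [w] and [z] are nonnegative. *)
    apply: le_trans (ulow _ Dx) _; rewrite lerDl dotvE sumr_ge0// => j _.
    rewrite mulr_ge0// mxE; case: splitP => k _; [exact: u0|].
    by rewrite mxE ler01.
  move=> /(_ _ yS); rewrite /H /= wE big1 ?addr0// => j _.
  by rewrite mxE mulr0.
apply/eqP; rewrite eq_le; apply/andP; split.
  apply: ge_ereal_sup => _ [u _ <-]; apply: ereal_inf_lbound.
  exists x0 => //; congr _%:E; rewrite /lagrangian big1 ?addr0// => j _.
  by rewrite gx0 mxE mulr0.
apply/lee_subgt0Pr => e e0; have [u u0 ulow] := dual e e0.
apply: (@le_trans _ _ (ereal_inf [set (lagrangian g f u x)%:E | x in D])).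
  by apply: le_ereal_inf_tmp => _ [x Dx <-]; rewrite -EFinB lee_fin ulow.
by apply: ereal_sup_ubound; exists u.
Qed.

(** * The two penalties and their multipliers *)

Lemma dotvN (R : realType) (n : nat) (u x : 'cV[R]_n) :
  dotv u (- x) = - dotv u x.
Proof. by rewrite /dotv mulmxN mxE. Qed.

Lemma dotvDl (R : realType) (n : nat) (u w x : 'cV[R]_n) :
  dotv (u + w) x = dotv u x + dotv w x.
Proof.
by rewrite !dotvE -big_split; apply: eq_bigr => i _; rewrite mxE mulrDl.
Qed.

Lemma dotvZl (R : realType) (n : nat) (u x : 'cV[R]_n) (t : R) :
  dotv (t *: u) x = t * dotv u x.
Proof.
by rewrite !dotvE mulr_sumr; apply: eq_bigr => i _; rewrite mxE mulrA.
Qed.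

Lemma dotv_suml (R : realType) (n k : nat) (u : 'I_k -> 'cV[R]_n)
    (x : 'cV[R]_n) : dotv (\sum_j u j) x = \sum_j dotv (u j) x.
Proof.
rewrite dotvE (eq_bigr (fun j => \sum_i u j i 0 * x i 0)); last first.
  by move=> j _; rewrite dotvE.
rewrite exchange_big /=; apply: eq_bigr => i _.
by rewrite summxE mulr_suml.
Qed.

Lemma dotv_delta (R : realType) (n : nat) (i : 'I_n) (x : 'cV[R]_n) :
  dotv (delta_mx i 0) x = x i 0.
Proof.
rewrite dotvE (bigD1 i)//= big1 ?addr0 => [|j /negPf ji].
  by rewrite mxE !eqxx mul1r.
by rewrite mxE ji mul0r.
Qed.

Lemma dotv_col_mx (R : realType) (p q : nat) (u x : 'cV[R]_p)
    (w y : 'cV[R]_q) :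
  dotv (col_mx u w) (col_mx x y) = dotv u x + dotv w y.
Proof. by rewrite /dotv tr_col_mx mul_row_col mxE. Qed.

Lemma orthant_col_mx (R : realType) (p q : nat) (u : 'cV[R]_p)
    (w : 'cV[R]_q) :
  orthant R p u -> orthant R q w -> orthant R (p + q) (col_mx u w).
Proof.
by move=> u0 w0 i; rewrite mxE; case: splitP => j _; [exact: u0 | exact: w0].
Qed.

Lemma orthant_const_mx (R : realType) (p : nat) (r : R) :
  0 <= r -> orthant R p (const_mx r).
Proof. by move=> r0 i; rewrite mxE. Qed.

Definition eq_penalty (R : realType) (n m : nat) (a : 'I_m -> 'cV[R]_n)
    (beta : 'I_m -> R) (x : 'cV[R]_n) : R :=
  \sum_j (dotv (a j) x - beta j) ^+ 2.

(** Its terms are negative where a coordinate exceeds 1, so it acts as a penalty only where (RA)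
    confines these coordinates to [0, 1]. *)
Definition bin_penalty (R : realType) (n s : nat) (hs : (s <= n)%N)
    (x : 'cV[R]_n) : R :=
  \sum_(i < s) x (widen_ord hs i) 0 * (1 - x (widen_ord hs i) 0).

Lemma continuous_eq_penalty (R : realType) (n m : nat)
    (a : 'I_m -> 'cV[R]_n) (beta : 'I_m -> R) :
  continuous (eq_penalty a beta).
Proof.
refine (continuous_bigsum _) => j.
have ca := continuous_add (@continuous_dotv _ _ (a j))
  (@cst_continuous _ _ (- beta j)).
exact: (continuous_mul ca ca).
Qed.

Lemma continuous_bin_penalty (R : realType) (n s : nat) (hs : (s <= n)%N) :
  continuous (@bin_penalty R n s hs).
Proof.
refine (continuous_bigsum _) => i.
have cx := @coord_cV_continuous R n (widen_ord hs i).
refine (continuous_mul cx (continuous_add (@cst_continuous _ R (1 : R)) _)).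
exact: (fun x => cvgN (cx x)).
Qed.

Lemma eq_penalty_ge0 (R : realType) (n m : nat) (a : 'I_m -> 'cV[R]_n)
    (beta : 'I_m -> R) (x : 'cV[R]_n) : 0 <= eq_penalty a beta x.
Proof. by apply: sumr_ge0 => j _; rewrite sqr_ge0. Qed.

Lemma eq_penalty_eq0 (R : realType) (n m : nat) (a : 'I_m -> 'cV[R]_n)
    (beta : 'I_m -> R) (x : 'cV[R]_n) :
  eq_penalty a beta x = 0 <-> forall j, dotv (a j) x = beta j.
Proof.
split=> [p0 j|ax]; last by apply: big1 => j _; rewrite ax subrr expr0n.
have /psumr_eq0P : forall j, true -> 0 <= (dotv (a j) x - beta j) ^+ 2.
  by move=> k _; rewrite sqr_ge0.
by move=> /(_ p0 j isT)/eqP; rewrite sqrf_eq0 subr_eq0 => /eqP.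
Qed.

(* K (t ^ 2 - beta ^ 2) - 2 K beta (t - beta) = K (t - beta) ^ 2: paired with
   the squared constraint, the linear one completes the square; the sign of
   its multiplier is absorbed by the first two blocks. *)
Lemma lagrangian_penalty (R : realType) (n m s : nat) (hs : (s <= n)%N)
    (a : 'I_m -> 'cV[R]_n) (beta : 'I_m -> R) (f : 'cV[R]_n -> R) (L K : R) :
  0 <= L -> 0 <= K ->
  exists2 u, orthant R (ncon m s) u & forall x,
    lagrangian (constraints hs a beta) f u x =
    f x + L * bin_penalty hs x + K * eq_penalty a beta x.
Proof.
move=> L0 K0; pose w j : R := - (2 * K * beta j).
(* The first two blocks hold the positive and negative parts of [w]; [K] multiplies the squared
   constraints and [L] the last block, whose entries are x_i (1 - x_i). *)
exists (col_mx (\col_j Num.max 0 (w j)) (col_mx (\col_j Num.max 0 (- w j))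
  (col_mx (const_mx K) (col_mx (const_mx 0) (col_mx (const_mx 0)
    (const_mx L)))))).
  by do !apply: orthant_col_mx; try (by apply: orthant_const_mx);
    move=> j; rewrite mxE le_max lexx.
move=> x; rewrite /lagrangian -dotvE /constraints !dotv_col_mx !dotvN.
have dot0 p (y : 'cV[R]_p) : dotv (const_mx 0) y = 0.
  by rewrite dotvE big1// => i _; rewrite mxE mul0r.
rewrite !dot0 oppr0 !add0r -addrA; congr (_ + _).
rewrite addrA addrA addrC; congr (_ + _).
  rewrite dotvE /bin_penalty mulr_sumr -sumrN; apply: eq_bigr => i _.
  by rewrite !mxE; ring.
rewrite !dotvE /eq_penalty mulr_sumr -sumrN -!big_split /=.
apply: eq_bigr => j _; rewrite !mxE /w.
have -> (t : R) : Num.max 0 (- t) = Num.max 0 t - t.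
  by case: (leP 0 t); case: (leP 0 (- t)); lra.
by rewrite opprK; ring.
Qed.

(** * Coercivity of the penalized objective and recession directions *)

(** Only the homogeneous quadratic part matters, in which [beta] becomes 0. It is positive on the
    part of the simplex where all a_j^T d vanish, and the exact penalty on the compact simplex
    yields one [K] making it positive on the whole simplex; this [K] serves every level [v]. *)
Lemma penalized_objective_coercive (R : realType) (n m s : nat)
    (hs : (s <= n)%N) (A : 'M[R]_n) (b : 'cV[R]_n) (c : R)
    (a : 'I_m -> 'cV[R]_n) (beta : 'I_m -> R) (L : R) :
  (forall d, simplex R n d -> (forall j, dotv (a j) d = 0) ->
    0 < qform A d - L * \sum_(i < s) d (widen_ord hs i) 0 ^+ 2) ->
  exists K, forall v, entry_bounded (orthant R n `&`
    [set x | objective A b c x + L * bin_penalty hs x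
             + K * eq_penalty a beta x <= v]).
Proof.
move=> pos.
pose sq (d : 'cV[R]_n) := \sum_(i < s) d (widen_ord hs i) 0 ^+ 2.
pose q d := qform A d + - L * sq d.
have cq : continuous q.
  refine (continuous_add (@continuous_qform R n A) (continuous_scale _)).
  refine (continuous_bigsum _) => i.
  have cx := @coord_cV_continuous R n (widen_ord hs i).
  exact: (continuous_mul cx cx).
have cp := @continuous_eq_penalty R n m a (fun=> 0).
have [||K K0 QK] := @penalty R n (simplex R n) q (eq_penalty a (fun=> 0)) 0 0
    (@closed_simplex R n) cq cp (fun x _ => eq_penalty_ge0 a (fun=> 0) x).
- exact: entry_boundedS (@subIsetl _ _ _) (@entry_bounded_simplex R n).
- move=> d dS /eq_penalty_eq0 ad; rewrite /q mulNr; exact: pos.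
exists K => v.
(* The linear part: that of the objective, that of [L] times the binary penalty, and the cross terms
   of the squares (a_j^T x - beta_j)^2. *)
pose w := b + L *: (\sum_(i < s) delta_mx (widen_ord hs i) 0)
  - (2 * K) *: (\sum_j beta j *: a j).
apply: (@coercive_quadratic R n (orthant R n)
  (fun d => q d + K * eq_penalty a (fun=> 0) d) _ w
  (c + K * \sum_j beta j ^+ 2)) => //.
- exact: continuous_add cq (continuous_scale cp).
- move=> t d; rewrite /q qformZ.
  have -> : sq (t *: d) = t ^+ 2 * sq d.
    by rewrite /sq mulr_sumr; apply: eq_bigr => i _; rewrite mxE exprMn.
  have -> : eq_penalty a (fun=> 0) (t *: d) =
      t ^+ 2 * eq_penalty a (fun=> 0) d.
    rewrite /eq_penalty mulr_sumr; apply: eq_bigr => j _.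
    by rewrite dotvZ !subr0 exprMn.
  by ring.
move=> x _; rewrite /w -scaleNr !dotvDl !dotvZl !dotv_suml /objective /q.
have -> : bin_penalty hs x = \sum_(i < s) dotv (delta_mx (widen_ord hs i) 0) x
    - sq x.
  rewrite /bin_penalty /sq -sumrN -big_split /=; apply: eq_bigr => i _.
  by rewrite dotv_delta; ring.
have -> : eq_penalty a beta x = eq_penalty a (fun=> 0) x
    - 2 * \sum_j dotv (beta j *: a j) x + \sum_j beta j ^+ 2.
  rewrite /eq_penalty mulr_sumr -sumrN -!big_split /=; apply: eq_bigr => j _.
  by rewrite dotvZl; ring.
by ring.
Qed.

(** Were d_i positive, moving from [x] along [d] by [2 / d i 0] would stay in the polyhedron and
    raise the coordinate to at least 2, against (RA). *)
Lemma recession_binary_eq0 (R : realType) (n m s : nat)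
    (a : 'I_m -> 'cV[R]_n) (beta : 'I_m -> R) (x d : 'cV[R]_n) :
  (forall y : 'cV[R]_n, orthant R n y -> (forall j, dotv (a j) y = beta j) ->
    forall i : 'I_n, (i < s)%N -> 0 <= y i 0 <= 1) ->
  orthant R n x -> (forall j, dotv (a j) x = beta j) ->
  orthant R n d -> (forall j, dotv (a j) d = 0) ->
  forall i : 'I_n, (i < s)%N -> d i 0 = 0.
Proof.
move=> RA x0 ax d0 ad i ilt; apply/eqP; rewrite eq_le d0 andbT leNgt.
apply/negP => di; pose t := 2 / d i 0.
have t0 : 0 <= t by rewrite divr_ge0// ltW.
have xt0 : orthant R n (x + t *: d).
  by move=> k; rewrite !mxE addr_ge0 ?(mulr_ge0 t0 (d0 k)) ?x0.
have axt j : dotv (a j) (x + t *: d) = beta j.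
  by rewrite dotvD dotvZ ad ax mulr0 addr0.
have := RA _ xt0 axt i ilt.
by rewrite !mxE divfK ?gt_eqF//; have := x0 i; lra.
Qed.

(** * Attainment of the minimum and the two exact-penalty steps *)

Theorem theorem3p1 (R : realType) (n m s : nat) (hs : (s <= n)%N)
    (A : 'M[R]_n) (b : 'cV[R]_n) (c : R)
    (a : 'I_m -> 'cV[R]_n) (beta : 'I_m -> R)
    (symA : A^T = A)
    (feas : miqp_feasible s a beta !=set0)
    (RA : forall d : 'cV[R]_n, orthant R n d ->
      (forall j, dotv (a j) d = beta j) ->
      forall i : 'I_n, (i < s)%N -> 0 <= d i 0 <= 1)
    (trivial_dirs :
      [set d : 'cV[R]_n | [/\ orthant R n d, qform A d <= 0,
          forall j, dotv (a j) d = 0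
        & forall i : 'I_n, (i < s)%N -> d i 0 = 0]] = [set 0]) :
  hidden_convexifiable hs A b c a beta /\
  miqp_value s A b c a beta =
    dual_value (orthant R n) (constraints hs a beta) (objective A b c).
Proof.
(* Such a [d] vanishes on the binary indices, so the term in [L] is zero; were the form nonpositive,
   [d] would be 0, against its coordinate sum 1. *)
have pos L d : simplex R n d -> (forall j, dotv (a j) d = 0) ->
    0 < qform A d - L * \sum_(i < s) d (widen_ord hs i) 0 ^+ 2.
  move=> [d0 d1] ad; have [y [ay _ y0]] := feas.
  have ds := recession_binary_eq0 RA y0 ay d0 ad.
  rewrite big1 ?mulr0 ?subr0 => [|i _]; last by rewrite ds ?expr0n//=.
  rewrite ltNge; apply/negP => qd.
  have : [set 0] d by rewrite -trivial_dirs.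
  move=> d_eq0; move: d1; rewrite d_eq0 /= big1 => [/eqP|i _]; last first.
    by rewrite mxE.
  by rewrite eq_sym oner_eq0.
pose f := objective A b c.
have cf : continuous f := @continuous_objective _ _ A b c.
have cE := @continuous_eq_penalty R n m a beta.
have cB := @continuous_bin_penalty R n s hs.
pose P := orthant R n `&` [set x | forall j, dotv (a j) x = beta j].
have closedP : closed P.
  apply: closedI; first exact: closed_orthant.
  by apply: closed_forall => j; apply: closed_level; exact: continuous_dotv.
(* With [L = 0], and with the equality penalty vanishing on [P], the penalized objective is [f]
   itself. *)
have boundedP v : entry_bounded (P `&` [set x | f x <= v]).
  have [K /(_ v)] := @penalized_objective_coercive R n m s hs A b c a beta
    0 (pos 0).
  apply: entry_boundedS => x [[x0 /eq_penalty_eq0 ax] /= fx].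
  by split=> //=; rewrite ax mul0r mulr0 !addr0.
have binP x : P x -> 0 <= bin_penalty hs x.
  move=> [x0 ax]; apply: sumr_ge0 => i _.
  have /andP[xi0 xi1] := RA x x0 ax (widen_ord hs i) (ltn_ord i).
  by rewrite mulr_ge0// subr_ge0.
have bin0 x : P x -> bin_penalty hs x = 0 <->
    forall i : 'I_n, (i < s)%N -> x i 0 = 0 \/ x i 0 = 1.
  move=> [x0 ax]; split=> [p0 i ilt|xi]; last first.
    apply: big1 => i _.
    case: (xi (widen_ord hs i) (ltn_ord i)) => ->; first by rewrite mul0r.
    by rewrite subrr mulr0.
  have /psumr_eq0P : forall k : 'I_s, true ->
      0 <= x (widen_ord hs k) 0 * (1 - x (widen_ord hs k) 0).
    move=> k _.
    have /andP[xi0 xi1] := RA x x0 ax (widen_ord hs k) (ltn_ord k).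
    by rewrite mulr_ge0// subr_ge0.
  move=> /(_ p0 (Ordinal ilt) isT).
  rewrite (_ : widen_ord hs _ = i); last exact: val_inj.
  by move/eqP; rewrite mulf_eq0 subr_eq0 eq_sym => /orP[]/eqP->; [left|right].
have feasE : miqp_feasible s a beta = P `&` [set x | bin_penalty hs x = 0].
  apply/seteqP; split=> x.
    by move=> [ax xi x0]; have Px : P x by []; split=> //; apply/bin0.
  by move=> [Px p0]; have [x0 ax] := Px; split=> //; exact/(bin0 _ Px).
(* The feasible points that are no worse than a given feasible [y] form a nonempty compact set. *)
have [x0 x0F x0min] : exists2 x, miqp_feasible s a beta x &
    forall y, miqp_feasible s a beta y -> f x <= f y.
  have [y yF] := feas.
  have closedF : closed (miqp_feasible s a beta).
    by rewrite feasE; apply: closedI => //; exact: closed_level.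
  have [||x [xF _] xmin] := @compact_min R _ f
      (miqp_feasible s a beta `&` [set x | f x <= f y]) _ _ cf.
  - by exists y; split=> //=.
  - apply: closed_entry_bounded_compact.
      by apply: closedI => //; exact: closed_sublevel.
    by apply: entry_boundedS (boundedP (f y)) => x []; rewrite feasE => -[].
  exists x => // z zF; have [fzy|/ltW fyz] := leP (f z) (f y).
    by apply: xmin; split.
  by apply: le_trans fyz; apply: xmin; split=> //=.
have x0P : P x0 by move: x0F; rewrite feasE => -[].
have gx0 : constraints hs a beta x0 = 0.
  have [ax xi _] := x0F; rewrite /constraints.
  have -> : \col_j (dotv (a j) x0 - beta j) = 0.
    by apply/matrixP => i j; rewrite !mxE ax subrr.
  have -> : \col_j (dotv (a j) x0 ^+ 2 - beta j ^+ 2) = 0.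
    by apply/matrixP => i j; rewrite !mxE ax subrr.
  have -> : \col_(i < s)
      (x0 (widen_ord hs i) 0 * (x0 (widen_ord hs i) 0 - 1)) = 0.
    apply/matrixP => i j; rewrite !mxE.
    case: (xi (widen_ord hs i) (ltn_ord i)) => ->; first by rewrite mul0r.
    by rewrite subrr mulr0.
  by rewrite !oppr0 !col_mx0.
have [||conv ->] := @strong_duality R n (ncon m s) (orthant R n)
    (constraints hs a beta) f x0 _ gx0.
- by case: x0P.
- move=> e e0.
  (* First penalty, on [P]: starting weight 0 suffices because [f] is already coercive there, and
     the slack [e] gives the strict inequality at feasible points. *)
  have [||L L0 fL] := @penalty R n P f (bin_penalty hs) 0 (f x0 - e) closedP cf
      cB binP.
  + apply: entry_boundedS (boundedP (f x0 - e)) => x [Px /=].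
    by rewrite mul0r addr0.
  + move=> x Px /(bin0 _ Px) xi; have [x_ge0 ax] := Px.
    by rewrite ltrBlDr (le_lt_trans (x0min x _))// ltrDl.
  (* Second penalty, on the orthant: [K1] is chosen after [L], and the points of zero equality
     penalty are those of [P], where [fL] applies. *)
  have [K1 K1coercive] := @penalized_objective_coercive R n m s hs A b c a beta
      L (pos L).
  have [|K K0 fK] := @penalty R n (orthant R n)
      (fun x => f x + L * bin_penalty hs x) (eq_penalty a beta) K1 (f x0 - e)
      (@closed_orthant R n) (continuous_add cf (continuous_scale cB)) cE
      (fun x _ => eq_penalty_ge0 a beta x) (K1coercive _).
    by move=> x x_ge0 /eq_penalty_eq0 ax; apply: fL.
  have [u u0 uE] := lagrangian_penalty hs a beta f L0 K0.
  by exists u => // x x_ge0; rewrite uE ltW// fK.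
split=> //; apply/eqP; rewrite eq_le; apply/andP; split.
  by apply: ereal_inf_lbound; exists x0.
by apply: le_ereal_inf_tmp => _ [x xF <-]; rewrite lee_fin x0min.
Qed.
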